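(* Let $\mathcal{A}=\mathcal{U}_q(\widehat{\mathfrak{gl}}(1|1))$ and let $\Theta$ be the involution of the root lattice $\mathbb{Z}\alpha_0\oplus\mathbb{Z}\alpha_1$ with $\Theta(\alpha_0)=-\alpha_1$. Let $d_\pm\in\mathbb{C}$ be arbitrary complex numbers and let $\mathcal{B}\subset\mathcal{A}$ be the associated subalgebra, generated by the Cartan elements $k_2$, $k_0k_1^{-1}$ and the twisted affine generators $$B_0^+=\xi_0'^{+}k_0-d_+\,\xi_1^-k_0,\qquad B_0^-=\xi_0^-k_0-d_-\,\xi_1'^{+}k_0,\qquad \xi_i'^{+}=k_i^{-1}\xi_i^+.$$ Then $\mathcal{B}$ is a left coideal subalgebra of $\mathcal{A}$: $\Delta(b)\in\mathcal{A}\otimes\mathcal{B}$ for all $b\in\mathcal{B}$.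
   Context: $q\in\mathbb{C}^\times$ is transcendental. $\mathcal{U}_q(\widehat{\mathfrak{gl}}(1|1))$ is the Hopf superalgebra generated by odd elements $\xi_0^\pm,\xi_1^\pm$ and even invertible $k_0,k_1,k_2$ ($k_2=q^{h_2}$), with relations $k_ik_j=k_jk_i$, $k_i\xi_j^\pm k_i^{-1}=q^{\pm\hat a_{ij}}\xi_j^\pm$, $\{\xi_i^+,\xi_j^-\}=\delta_{ij}\frac{k_i-k_i^{-1}}{q-q^{-1}}$ ($i,j\in\{0,1\}$ in the last relation) and the standard Serre relations (in particular $(\xi_i^\pm)^2=0$), where $$(\hat a_{ij})_{0\le i,j\le2}=\begin{pmatrix}0&0&-2\\0&0&2\\-2&2&0\end{pmatrix}.$$ Coproduct: $\Delta(k_i)=k_i\otimes k_i$, $\Delta(\xi_i^+)=\xi_i^+\otimes1+k_i\otimes\xi_i^+$, $\Delta(\xi_i^-)=\xi_i^-\otimes k_i^{-1}+1\otimes\xi_i^-$; tensor products are graded. *)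

(* Defs.v *)
From HB Require Import structures.
From mathcomp Require Import all_boot all_order all_algebra.
From mathcomp Require Import boolp classical_sets reals complex.

Set Implicit Arguments.
Unset Strict Implicit.
Unset Printing Implicit Defensive.

Import Order.TTheory GRing.Theory Num.Theory.

Local Open Scope ring_scope.
Local Open Scope quotient_scope.

Section TensorCongruence.
Variables (K : fieldType) (V W : lmodType K).
Implicit Types s t : seq (V * W).

(* A list of pairs [(v_1, w_1); ...; (v_n, w_n)] stands for the formal sum
   v_1 (x) w_1 + ... + v_n (x) w_n. *)
Inductive tens_eqv : seq (V * W) -> seq (V * W) -> Prop :=
| te_refl s : tens_eqv s s
| te_sym s t : tens_eqv s t -> tens_eqv t s
| te_trans s t u : tens_eqv s t -> tens_eqv t u -> tens_eqv s u
| te_cat s s' t t' :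
    tens_eqv s s' -> tens_eqv t t' -> tens_eqv (s ++ t) (s' ++ t')
| te_catC s t : tens_eqv (s ++ t) (t ++ s)
| te_zero w : tens_eqv [:: (0, w)] [::]
| te_addl v v' w : tens_eqv [:: (v + v', w)] [:: (v, w); (v', w)]
| te_addr v w w' : tens_eqv [:: (v, w + w')] [:: (v, w); (v, w')]
| te_scale c v w : tens_eqv [:: (c *: v, w)] [:: (v, c *: w)].

Definition tens_rel : rel (seq (V * W)) := fun s t => `[< tens_eqv s t >].

Lemma tens_rel_refl : reflexive tens_rel.
Proof. by move=> s; apply/asboolP/te_refl. Qed.

Lemma tens_rel_sym : symmetric tens_rel.
Proof. by move=> s t; apply/asboolP/asboolP; apply: te_sym. Qed.

Lemma tens_rel_trans : transitive tens_rel.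
Proof.
by move=> s t u /asboolP h1 /asboolP h2; apply/asboolP/(te_trans h1 h2).
Qed.

Canonical tens_equiv_rel :=
  EquivRel tens_rel tens_rel_refl tens_rel_sym tens_rel_trans.

End TensorCongruence.

Definition tens (K : fieldType) (V W : lmodType K) : Type :=
  {eq_quot tens_equiv_rel V W}.

Section TensorModule.
Variables (K : fieldType) (V W : lmodType K).
Implicit Types s t : seq (V * W).
Local Notation T := (tens V W).

HB.instance Definition _ := Choice.copy T {eq_quot tens_equiv_rel V W}.

Definition tcls s : T := \pi_({eq_quot tens_equiv_rel V W}) s.
Definition trep (x : T) : seq (V * W) :=
  repr (x : {eq_quot tens_equiv_rel V W}).

Lemma tclsP s t : tens_eqv s t <-> tcls s = tcls t.
Proof.
split=> [h|/eqquotP/asboolP //].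
by apply/eqquotP/asboolP.
Qed.

Lemma trepK x : tcls (trep x) = x.
Proof. exact: reprK. Qed.

Lemma trep_cls s : tens_eqv (trep (tcls s)) s.
Proof. by apply/tclsP; rewrite trepK. Qed.

Definition tzscale c s : seq (V * W) := [seq (c *: p.1, p.2) | p <- s].

Lemma tzscale_eqv c s t : tens_eqv s t -> tens_eqv (tzscale c s) (tzscale c t).
Proof.
elim=> {s t}.
- by move=> s; exact: te_refl.
- by move=> s t _; exact: te_sym.
- by move=> s t u _ + _; exact: te_trans.
- by move=> s s' t t' _ h1 _ h2; rewrite /tzscale !map_cat; exact: te_cat.
- by move=> s t; rewrite /tzscale !map_cat; exact: te_catC.
- by move=> w /=; rewrite scaler0; exact: te_zero.
- by move=> v v' w /=; rewrite scalerDr; exact: te_addl.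
- by move=> v w w' /=; exact: te_addr.
- move=> d v w /=; rewrite scalerA mulrC -scalerA; exact: te_scale.
Qed.

Definition tzero : T := tcls [::].
Definition tadd (x y : T) : T := tcls (trep x ++ trep y).
Definition tscale c (x : T) : T := tcls (tzscale c (trep x)).
Definition topp : T -> T := tscale (-1).

Lemma tadd_cls s t : tadd (tcls s) (tcls t) = tcls (s ++ t).
Proof. by apply/tclsP/te_cat; exact: trep_cls. Qed.

Lemma tscale_cls c s : tscale c (tcls s) = tcls (tzscale c s).
Proof. by apply/tclsP/tzscale_eqv/trep_cls. Qed.

Lemma taddA : associative tadd.
Proof.
move=> x y z; rewrite -(trepK x) -(trepK y) -(trepK z) !tadd_cls.
by rewrite catA.
Qed.

Lemma taddC : commutative tadd.
Proof. by move=> x y; apply/tclsP/te_catC. Qed.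

Lemma tadd0 : left_id tzero tadd.
Proof. by move=> x; rewrite -(trepK x) tadd_cls. Qed.

Lemma te_opp s : tens_eqv (tzscale (-1) s ++ s) [::].
Proof.
elim: s => [|[v w] s IH]; first exact: te_refl.
have -> : tzscale (-1) ((v, w) :: s) ++ (v, w) :: s =
          [:: (-1 *: v, w)] ++ ((tzscale (-1) s ++ [:: (v, w)]) ++ s).
  by rewrite /= -catA.
apply: te_trans (_ : tens_eqv ([:: (-1 *: v, w); (v, w)] ++
                               (tzscale (-1) s ++ s)) _).
  rewrite -[X in tens_eqv _ X]/([:: (-1 *: v, w)] ++ ([:: (v, w)] ++ _)).
  apply: te_cat; first exact: te_refl.
  rewrite catA; apply: te_cat; last exact: te_refl.
  exact: te_catC.
rewrite -[[::]]/(([::] : seq (V * W)) ++ [::]); apply: te_cat => //.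
apply: te_trans (te_sym (te_addl _ _ _)) _.
by rewrite scaleN1r addNr; exact: te_zero.
Qed.

Lemma taddN : left_inverse tzero topp tadd.
Proof.
by move=> x; rewrite -(trepK x) /topp tscale_cls tadd_cls; apply/tclsP/te_opp.
Qed.

HB.instance Definition _ := GRing.isZmodule.Build T taddA taddC tadd0 taddN.

Lemma tcls_cat s t : tcls (s ++ t) = tcls s + tcls t.
Proof. by rewrite -tadd_cls. Qed.

Lemma tscaleA a b x : tscale a (tscale b x) = tscale (a * b) x.
Proof.
rewrite -(trepK x) !tscale_cls; congr tcls; rewrite /tzscale -map_comp.
by apply: eq_map => p /=; rewrite scalerA.
Qed.

Lemma tscale1 : left_id 1 tscale.
Proof.
move=> x; rewrite -[in LHS](trepK x) tscale_cls -[RHS]trepK; congr tcls.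
by rewrite /tzscale -[RHS]map_id; apply: eq_map => -[v w] /=; rewrite scale1r.
Qed.

Lemma tscaleDr : right_distributive tscale +%R.
Proof.
move=> c x y; rewrite -(trepK x) -(trepK y) -tcls_cat !tscale_cls -tcls_cat.
by rewrite /tzscale map_cat.
Qed.

Lemma tscaleDl x : {morph tscale^~ x : a b / a + b}.
Proof.
move=> a b; rewrite -(trepK x) !tscale_cls; elim: (trep x) => [|[v w] s IH].
  by rewrite /tzscale /= -[RHS]tcls_cat.
rewrite /tzscale /= -!/(tzscale _ _) -[_ :: tzscale (a + b) s]cat1s.
rewrite -[_ :: tzscale a s]cat1s -[_ :: tzscale b s]cat1s.
rewrite !tcls_cat IH addrACA; congr (_ + _); rewrite -tcls_cat.
by apply/tclsP; rewrite scalerDl; exact: te_addl.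
Qed.

HB.instance Definition _ :=
  GRing.Zmodule_isLmodule.Build K T tscaleA tscale1 tscaleDr tscaleDl.

Definition tpure (v : V) (w : W) : T := tcls [:: (v, w)].

Lemma tclsE s : tcls s = \sum_(p <- s) tpure p.1 p.2.
Proof.
elim: s => [|[v w] s IH]; first by rewrite big_nil.
by rewrite big_cons -IH -[_ :: s]cat1s tcls_cat.
Qed.

Lemma tpureDl v v' w : tpure (v + v') w = tpure v w + tpure v' w.
Proof. by rewrite -tcls_cat; apply/tclsP/te_addl. Qed.

Lemma tpureDr v w w' : tpure v (w + w') = tpure v w + tpure v w'.
Proof. by rewrite -tcls_cat; apply/tclsP/te_addr. Qed.

Lemma tpureZl c v w : tpure (c *: v) w = c *: tpure v w.
Proof. by rewrite -[RHS]/(tscale _ _) tscale_cls. Qed.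

Lemma tpureZr c v w : tpure v (c *: w) = c *: tpure v w.
Proof. by rewrite -tpureZl; apply/tclsP/te_sym/te_scale. Qed.

Lemma tpure0l w : tpure 0 w = 0.
Proof. by apply/tclsP/te_zero. Qed.

Lemma tpure0r v : tpure v 0 = 0.
Proof. by rewrite -(scale0r 0) tpureZr scale0r. Qed.

Lemma tpureBl v v' w : tpure (v - v') w = tpure v w - tpure v' w.
Proof. by rewrite tpureDl -scaleN1r tpureZl scaleN1r. Qed.

Lemma tpureBr v w w' : tpure v (w - w') = tpure v w - tpure v w'.
Proof. by rewrite tpureDr -scaleN1r tpureZr scaleN1r. Qed.

Lemma tens_ind (P : T -> Prop) :
  P 0 -> (forall v w, P (tpure v w)) ->
  (forall x y, P x -> P y -> P (x + y)) -> forall x, P x.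
Proof.
move=> P0 Pp PD x; rewrite -(trepK x) tclsE.
by elim/big_ind: _ => // p _; exact: Pp.
Qed.

Section Lift.
Variables (U : lmodType K) (f : V -> W -> U).

Definition bilinear_fun :=
  (forall c v v' w, f (c *: v + v') w = c *: f v w + f v' w) /\
  (forall c v w w', f v (c *: w + w') = c *: f v w + f v w').

Definition tlift (x : T) : U := \sum_(p <- trep x) f p.1 p.2.

Hypothesis fL : bilinear_fun.

Lemma tlift_f0 w : f 0 w = 0.
Proof.
by case: fL => fl _; have := fl (-1) 0 0 w; rewrite scaler0 add0r scaleN1r addNr.
Qed.

Lemma tlift_cls s : tlift (tcls s) = \sum_(p <- s) f p.1 p.2.
Proof.
have [fl fr] := fL.
have f0l := tlift_f0.
have f0r v : f v 0 = 0 by have := fr (-1) v 0 0; rewrite scaler0 add0r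
   scaleN1r addNr.
suff H t u : tens_eqv t u -> \sum_(p <- t) f p.1 p.2 = \sum_(p <- u) f p.1 p.2.
  exact/H/trep_cls.
elim=> {t u s} //.
- by move=> s t u _ -> _ ->.
- by move=> s s' t t' _ h1 _ h2; rewrite !big_cat /= h1 h2.
- by move=> s t; rewrite !big_cat /= addrC.
- by move=> w; rewrite big_seq1 big_nil f0l.
- move=> v v' w; rewrite big_seq1 big_cons big_seq1 /=.
  by have := fl 1 v v' w; rewrite !scale1r.
- move=> v w w'; rewrite big_seq1 big_cons big_seq1 /=.
  by have := fr 1 v w w'; rewrite !scale1r.
- move=> c v w; rewrite !big_seq1 /=.
  by have := fl c v 0 w; have := fr c v w 0; rewrite f0l f0r !addr0 => -> ->.
Qed.

Lemma tlift_pure v w : tlift (tpure v w) = f v w.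
Proof. by rewrite tlift_cls big_seq1. Qed.

Lemma tliftD x y : tlift (x + y) = tlift x + tlift y.
Proof.
by rewrite -(trepK x) -(trepK y) -tcls_cat !tlift_cls big_cat.
Qed.

Lemma tliftZ c x : tlift (c *: x) = c *: tlift x.
Proof.
rewrite -(trepK x) [c *: _]tscale_cls !tlift_cls big_map scaler_sumr.
apply: eq_bigr => p _ /=.
by have [fl _] := fL; have := fl c p.1 0 p.2; rewrite tlift_f0 !addr0.
Qed.

End Lift.

(* The image of V' (x) W' in V (x) W, for V' and W' subsets (in practice
   subspaces) of V and W. *)
Definition tens_span (V' : set V) (W' : set W) : set T :=
  [set x | exists s : seq (V * W),
     (forall p, p \in s -> V' p.1 /\ W' p.2) /\
     x = \sum_(p <- s) tpure p.1 p.2]%classic.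

End TensorModule.

Arguments tpure {K V W}.
Notation "a ⊗ b" := (tpure a b) (at level 38, no associativity) : ring_scope.

(* [hpart false a] and [hpart true a] are the even and the odd component
   of [a]. *)
HB.mixin Record isSuperAlgebra (K : fieldType) A of GRing.Algebra K A := {
  hpart : bool -> A -> A;
  hpart_linear : forall i c a b, hpart i (c *: a + b) = c *: hpart i a + hpart i b;
  hpart_sum : forall a, hpart false a + hpart true a = a;
  hpart_hpart : forall i j a, hpart i (hpart j a) = if i == j then hpart j a else 0;
  hpart1 : hpart false 1 = 1;
  hpartM : forall i j a b, hpart i a = a -> hpart j b = b ->
     hpart (i (+) j) (a * b) = a * b
}.

#[short(type="superAlgType")]
HB.structure Definition SuperAlgebra (K : fieldType) :=
  {A of isSuperAlgebra K A & GRing.Algebra K A}.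

Definition stensor (K : fieldType) (A : superAlgType K) : Type := tens A A.

Section SuperTensor.
Variables (K : fieldType) (A : superAlgType K).
Implicit Types (a b c d : A).
Local Notation T := (stensor A).

HB.instance Definition _ := GRing.Lmodule.copy T (tens A A).

(* (a ⊗ b)(c ⊗ d) = (-1)^(|b||c|) ac ⊗ bd, extended linearly. *)
Definition smul_pure a b c d : T :=
  \sum_(i : bool) \sum_(j : bool)
     (-1) ^+ (i && j) *: ((a * hpart j c) ⊗ (hpart i b * d)).

Definition smul (x y : T) : T :=
  tlift (fun a b => tlift (fun c d => smul_pure a b c d) y) x.

Definition sone : T := 1 ⊗ 1.

Lemma hpartD i a b : hpart i (a + b) = hpart i a + hpart i b.
Proof. by have := hpart_linear i 1 a b; rewrite !scale1r. Qed.

Lemma hpart0 i : hpart i (0 : A) = 0.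
Proof. by have := hpart_linear i (-1) 0 (0 : A); rewrite scaler0 add0r
  scaleN1r addNr. Qed.

Lemma smul_pure_bilr a b : bilinear_fun (smul_pure a b).
Proof.
split=> [k c c' d|k c d d']; rewrite /smul_pure scaler_sumr -big_split /=;
  apply: eq_bigr => i _; rewrite scaler_sumr -big_split /=;
  apply: eq_bigr => j _; rewrite scalerA mulrC -scalerA -scalerDr; congr (_ *: _).
- by rewrite hpart_linear mulrDr tpureDl -scalerAr tpureZl.
- by rewrite mulrDr tpureDr -scalerAr tpureZr.
Qed.

Lemma smul_pure_bill (y : T) :
  bilinear_fun (fun a b => tlift (fun c d => smul_pure a b c d) y).
Proof.
split=> [k a a' b|k a b b']; rewrite /tlift scaler_sumr -big_split /=;
  apply: eq_bigr => p _; rewrite /smul_pure scaler_sumr -big_split /=;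
  apply: eq_bigr => i _; rewrite scaler_sumr -big_split /=;
  apply: eq_bigr => j _; rewrite scalerA mulrC -scalerA -scalerDr; congr (_ *: _).
- by rewrite mulrDl tpureDl -scalerAl tpureZl.
- by rewrite hpart_linear mulrDl tpureDr -scalerAl tpureZr.
Qed.

Lemma smul_pureE a b c d :
  smul (a ⊗ b) (c ⊗ d) = smul_pure a b c d.
Proof.
by rewrite /smul (tlift_pure (smul_pure_bill _)) (tlift_pure (smul_pure_bilr _ _)).
Qed.

Lemma smulDl : left_distributive smul +%R.
Proof. by move=> x y z; exact: (tliftD (smul_pure_bill z)). Qed.

Lemma smulZl k (x y : T) : smul (k *: x) y = k *: smul x y.
Proof. exact: (tliftZ (smul_pure_bill y)). Qed.

Lemma smulDr : right_distributive smul +%R.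
Proof.
move=> x y z; rewrite -big_split; apply: eq_bigr => p _ /=.
exact: (tliftD (smul_pure_bilr _ _)).
Qed.

Lemma smulZr k (x y : T) : smul x (k *: y) = k *: smul x y.
Proof.
rewrite /smul [in RHS]/tlift scaler_sumr; apply: eq_bigr => p _ /=.
exact: (tliftZ (smul_pure_bilr _ _)).
Qed.

Lemma smul_hom i j a b c d : hpart i b = b -> hpart j c = c ->
  smul (a ⊗ b) (c ⊗ d) = (-1) ^+ (i && j) *: ((a * c) ⊗ (b * d)).
Proof.
move=> hb hc; rewrite smul_pureE /smul_pure.
rewrite (bigD1 i) //= (bigD1 j) //= hb hc big1 ?big1 ?addr0 //.
- by move=> i' /negbTE ni; rewrite big1 // => j' _;
    rewrite -hb hpart_hpart ni mul0r tpure0r scaler0.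
- by move=> j' /negbTE nj; rewrite -hc hpart_hpart nj mulr0 tpure0l scaler0.
Qed.

Lemma stensor_ind (P : T -> Prop) :
  P 0 -> (forall x y, P x -> P y -> P (x + y)) ->
  (forall i j a b, hpart i a = a -> hpart j b = b -> P (a ⊗ b)) ->
  forall x, P x.
Proof.
move=> P0 PD Pp; apply: tens_ind => // a b.
rewrite -(hpart_sum a) -(hpart_sum b) tpureDl !tpureDr.
have hh i c : hpart i (hpart i c) = hpart i c :> A by rewrite hpart_hpart eqxx.
by apply: (PD); apply: (PD); apply: (Pp); exact: hh.
Qed.

Lemma smul0l x : smul 0 x = 0.
Proof. by rewrite -(scale0r (0 : T)) smulZl !scale0r. Qed.

Lemma smul0r x : smul x 0 = 0.
Proof. by rewrite -(scale0r (0 : T)) smulZr !scale0r. Qed.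

Lemma smulA : associative smul.
Proof.
move=> x y z.
elim/stensor_ind: x => [|x x' IH IH'|i j a b ha hb].
- by rewrite !smul0l.
- by rewrite !smulDl IH IH'.
elim/stensor_ind: y => [|y y' IH IH'|k l c d hc hd].
- by rewrite smul0l smul0r smul0l.
- by rewrite !(smulDl, smulDr) IH IH'.
elim/stensor_ind: z => [|z z' IH IH'|m n e f he hf].
- by rewrite !smul0r.
- by rewrite !smulDr IH IH'.
rewrite (smul_hom _ _ hb hc) (smul_hom _ _ hd he) smulZl smulZr.
rewrite (smul_hom _ _ (hpartM _ _ _ _ hb hd) he) (smul_hom _ _ hb (hpartM _ _ _ _ hc he)).
rewrite !scalerA !mulrA -!signr_addb; congr (_ *: _).
by case: j hb; case: k hc; case: l hd; case: m he => /= *;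
  rewrite ?mulrN1 ?mulN1r ?mulr1 ?mul1r.
Qed.

Lemma smul1l : left_id sone smul.
Proof.
elim/stensor_ind => [|x y IH IH'|i j a b ha hb].
- by rewrite smul0r.
- by rewrite smulDr IH IH'.
- by rewrite (smul_hom _ _ hpart1 ha) scale1r !mul1r.
Qed.

Lemma smul1r : right_id sone smul.
Proof.
elim/stensor_ind => [|x y IH IH'|i j a b ha hb].
- by rewrite smul0l.
- by rewrite smulDl IH IH'.
- by rewrite (smul_hom _ _ hb hpart1) andbF scale1r !mulr1.
Qed.

(* Multiplication of [A], being bilinear, factors through [tens A A] and maps
   1 ⊗ 1 to 1. *)
Lemma sone_neq0 : sone != 0.
Proof.
have mB : bilinear_fun (fun a b : A => a * b).
  by split=> *; rewrite (mulrDl, mulrDr) -(scalerAl, scalerAr).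
apply/eqP => /(congr1 (tlift (fun a b : A => a * b))).
rewrite (tlift_pure mB) mulr1 -(scale0r (0 : T)) (tliftZ mB) scale0r.
by apply/eqP/oner_neq0.
Qed.

HB.instance Definition _ :=
  GRing.Zmodule_isNzRing.Build T smulA smul1l smul1r smulDl smulDr sone_neq0.

HB.instance Definition _ := GRing.Lmodule_isLalgebra.Build K T
  (fun k x y => esym (smulZl k x y)).

HB.instance Definition _ := GRing.Lalgebra_isAlgebra.Build K T
  (fun k x y => esym (smulZr k x y)).

Lemma stensorM i j a b c d : hpart i b = b -> hpart j c = c ->
  ((a ⊗ b : T) * (c ⊗ d : T))%R = (-1) ^+ (i && j) *: ((a * c) ⊗ (b * d)).
Proof. exact: smul_hom. Qed.

Lemma stensorM_evenl a b c d : hpart false b = b ->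
  ((a ⊗ b : T) * (c ⊗ d : T))%R = (a * c) ⊗ (b * d).
Proof.
move=> hb; have hh i : hpart i (hpart i c) = hpart i c.
  by rewrite hpart_hpart eqxx.
rewrite -{1 2}(hpart_sum c) tpureDl mulrDr !(stensorM _ _ hb (hh _)) !scale1r.
by rewrite mulrDr tpureDl.
Qed.

Lemma stensorM_evenr a b c d : hpart false c = c ->
  ((a ⊗ b : T) * (c ⊗ d : T))%R = (a * c) ⊗ (b * d).
Proof.
move=> hc; have hh i : hpart i (hpart i b) = hpart i b.
  by rewrite hpart_hpart eqxx.
rewrite -{1 2}(hpart_sum b) tpureDr mulrDl !(stensorM _ _ (hh _) hc) !scale1r.
by rewrite mulrDl tpureDr.
Qed.

Lemma stensorM_odd a b c d : hpart true b = b -> hpart true c = c ->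
  ((a ⊗ b : T) * (c ⊗ d : T))%R = - ((a * c) ⊗ (b * d)).
Proof. by move=> hb hc; rewrite (stensorM _ _ hb hc) scaleN1r. Qed.

End SuperTensor.

Section Presentation.
Variables (K : numFieldType) (q : K).

(* [Xi s i] is ξ_i^+ for [s = true] and ξ_i^- for [s = false]. *)
Inductive Uq_gen := Xi of bool & 'I_2 | Kk of 'I_3 | KkV of 'I_3.

Definition odd_gen (g : Uq_gen) : bool := if g is Xi _ _ then true else false.

(* Noncommutative polynomial expressions in the generators. *)
Inductive Uq_term :=
  | TC of K
  | TG of Uq_gen
  | TD of Uq_term & Uq_term
  | TM of Uq_term & Uq_term.

Fixpoint eval (B : algType K) (f : Uq_gen -> B) (t : Uq_term) : B :=
  match t with
  | TC c => c%:A
  | TG g => f g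
  | TD a b => eval f a + eval f b
  | TM a b => eval f a * eval f b
  end.

Declare Scope uq_scope.
Delimit Scope uq_scope with U.
Local Notation "c %:U" := (TC c) (at level 1, format "c %:U") : uq_scope.
Local Notation "a + b" := (TD a b) : uq_scope.
Local Notation "a - b" := (TD a (TM (TC (-1)) b)) : uq_scope.
Local Notation "a * b" := (TM a b) : uq_scope.
Local Notation Txi s i := (TG (Xi s i)).
Local Notation Tk i := (TG (Kk i)).
Local Notation TkV i := (TG (KkV i)).

Definition ahat (i j : 'I_3) : int :=
  nth 0 (nth [::] [:: [:: 0; 0; -2]; [:: 0; 0; 2]; [:: -2; 2; 0]] i) j.

Definition w23 : 'I_2 -> 'I_3 := widen_ord (isT : (2 <= 3)%N).

Local Open Scope uq_scope.

(* The Serre relations of higher degree, [ξ_i^±, {ξ_i^±, ξ_j^±}] = 0, follow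
   from (ξ_i^±)^2 = 0: see [serre3] below. *)
Inductive Uq_rel : Uq_term -> Uq_term -> Prop :=
| Rkk i j : Uq_rel (Tk i * Tk j) (Tk j * Tk i)
| RkkV i : Uq_rel (Tk i * TkV i) 1%:U
| RkVk i : Uq_rel (TkV i * Tk i) 1%:U
| Rkxi s (i : 'I_3) (j : 'I_2) :
    Uq_rel (Tk i * Txi s j * TkV i)
           ((q ^ ((if s then 1 else -1) * ahat i (w23 j))%R)%:U * Txi s j)
| Rxixi i j :
    Uq_rel (Txi true i * Txi false j + Txi false j * Txi true i)
           (((i == j)%:R / (q - q^-1))%R%:U * (Tk (w23 i) - TkV (w23 i)))
| Rserre s i : Uq_rel (Txi s i * Txi s i) 0%:U.

(* The least algebra congruence containing the defining relations: equality in
   the free algebra modulo the two-sided ideal of relations. *)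
Inductive Uq_eqv : Uq_term -> Uq_term -> Prop :=
| Ue_rel t u : Uq_rel t u -> Uq_eqv t u
| Ue_refl t : Uq_eqv t t
| Ue_sym t u : Uq_eqv t u -> Uq_eqv u t
| Ue_trans t u v : Uq_eqv t u -> Uq_eqv u v -> Uq_eqv t v
| Ue_add t t' u u' : Uq_eqv t t' -> Uq_eqv u u' -> Uq_eqv (t + u) (t' + u')
| Ue_mul t t' u u' : Uq_eqv t t' -> Uq_eqv u u' -> Uq_eqv (t * u) (t' * u')
| Ue_addA t u v : Uq_eqv (t + (u + v)) (t + u + v)
| Ue_addC t u : Uq_eqv (t + u) (u + t)
| Ue_add0 t : Uq_eqv (0%:U + t) t
| Ue_addN t : Uq_eqv ((-1)%R%:U * t + t) 0%:U
| Ue_mulA t u v : Uq_eqv (t * (u * v)) (t * u * v)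
| Ue_mul1 t : Uq_eqv (1%:U * t) t
| Ue_mulDl t u v : Uq_eqv ((t + u) * v) (t * v + u * v)
| Ue_mulDr t u v : Uq_eqv (t * (u + v)) (t * u + t * v)
| Ue_scalD a b : Uq_eqv (a%:U + b%:U) (a + b)%R%:U
| Ue_scalM a b : Uq_eqv (a%:U * b%:U) (a * b)%R%:U
| Ue_scalC a t : Uq_eqv (a%:U * t) (t * a%:U).

Local Close Scope uq_scope.

Lemma eval_eqv (B : algType K) (f : Uq_gen -> B) :
  (forall t u, Uq_rel t u -> eval f t = eval f u) ->
  forall t u, Uq_eqv t u -> eval f t = eval f u.
Proof.
move=> fP t u; elim=> {t u} /=.
- exact: fP.
- by [].
- by [].
- by move=> t u v _ -> _ ->.
- by move=> t t' u u' _ -> _ ->.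
- by move=> t t' u u' _ -> _ ->.
- by move=> *; rewrite addrA.
- by move=> *; rewrite addrC.
- by move=> *; rewrite scale0r add0r.
- by move=> t; rewrite -scalerAl mul1r scaleN1r addNr scale0r.
- by move=> *; rewrite mulrA.
- by move=> *; rewrite scale1r mul1r.
- by move=> *; rewrite mulrDl.
- by move=> *; rewrite mulrDr.
- by move=> *; rewrite scalerDl.
- by move=> *; rewrite -scalerAl mul1r scalerA.
- by move=> *; rewrite -scalerAl -scalerAr mul1r mulr1.
Qed.

HB.instance Definition _ := gen_eqMixin Uq_term.
HB.instance Definition _ := gen_choiceMixin Uq_term.

Definition Uq_relb : rel Uq_term := fun t u => `[< Uq_eqv t u >].

Lemma Uq_relb_refl : reflexive Uq_relb.
Proof. by move=> s; apply/asboolP/Ue_refl. Qed.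

Lemma Uq_relb_sym : symmetric Uq_relb.
Proof. by move=> s t; apply/asboolP/asboolP; apply: Ue_sym. Qed.

Lemma Uq_relb_trans : transitive Uq_relb.
Proof.
by move=> s t u /asboolP h1 /asboolP h2; apply/asboolP/(Ue_trans h1 h2).
Qed.

Canonical Uq_equiv_rel :=
  EquivRel Uq_relb Uq_relb_refl Uq_relb_sym Uq_relb_trans.

Definition Uq : Type := {eq_quot Uq_equiv_rel}.

HB.instance Definition _ := Choice.copy Uq {eq_quot Uq_equiv_rel}.

Definition ucls (t : Uq_term) : Uq := \pi_({eq_quot Uq_equiv_rel}) t.
Definition urep (x : Uq) : Uq_term := repr (x : {eq_quot Uq_equiv_rel}).

Lemma uclsP t u : Uq_eqv t u <-> ucls t = ucls u.
Proof. by split=> [h|/eqquotP/asboolP //]; apply/eqquotP/asboolP. Qed.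

Lemma urepK x : ucls (urep x) = x.
Proof. exact: reprK. Qed.

Lemma urep_cls t : Uq_eqv (urep (ucls t)) t.
Proof. by apply/uclsP; rewrite urepK. Qed.

Definition uadd (x y : Uq) : Uq := ucls (urep x + urep y)%U.
Definition umul (x y : Uq) : Uq := ucls (urep x * urep y)%U.
Definition uscale (c : K) (x : Uq) : Uq := ucls (c%:U * urep x)%U.
Definition uopp : Uq -> Uq := uscale (-1).

Lemma uaddE t u : uadd (ucls t) (ucls u) = ucls (t + u)%U.
Proof. by apply/uclsP/Ue_add; exact: urep_cls. Qed.

Lemma umulE t u : umul (ucls t) (ucls u) = ucls (t * u)%U.
Proof. by apply/uclsP/Ue_mul; exact: urep_cls. Qed.

Lemma uscaleE c t : uscale c (ucls t) = ucls (c%:U * t)%U.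
Proof. by apply/uclsP/Ue_mul; [exact: Ue_refl|exact: urep_cls]. Qed.

Lemma uaddA : associative uadd.
Proof.
move=> x y z; rewrite -(urepK x) -(urepK y) -(urepK z) !uaddE.
exact/uclsP/Ue_addA.
Qed.

Lemma uaddC : commutative uadd.
Proof. by move=> x y; apply/uclsP/Ue_addC. Qed.

Lemma uadd0 : left_id (ucls 0%:U%U) uadd.
Proof. by move=> x; rewrite -(urepK x) uaddE; apply/uclsP/Ue_add0. Qed.

Lemma uaddN : left_inverse (ucls 0%:U%U) uopp uadd.
Proof.
by move=> x; rewrite -(urepK x) /uopp uscaleE uaddE; apply/uclsP/Ue_addN.
Qed.

HB.instance Definition _ := GRing.isZmodule.Build Uq uaddA uaddC uadd0 uaddN.

Lemma umulA : associative umul.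
Proof.
move=> x y z; rewrite -(urepK x) -(urepK y) -(urepK z) !umulE.
exact/uclsP/Ue_mulA.
Qed.

Lemma umul1l : left_id (ucls 1%:U%U) umul.
Proof. by move=> x; rewrite -(urepK x) umulE; apply/uclsP/Ue_mul1. Qed.

Lemma umul1r : right_id (ucls 1%:U%U) umul.
Proof.
move=> x; rewrite -(urepK x) umulE; apply/uclsP.
exact: Ue_trans (Ue_sym (Ue_scalC _ _)) (Ue_mul1 _).
Qed.

Lemma umulDl : left_distributive umul +%R.
Proof.
move=> x y z; rewrite -(urepK x) -(urepK y) -(urepK z) [_ + _]uaddE !umulE.
rewrite [RHS]uaddE; exact/uclsP/Ue_mulDl.
Qed.

Lemma umulDr : right_distributive umul +%R.
Proof.
move=> x y z; rewrite -(urepK x) -(urepK y) -(urepK z) [_ + _]uaddE !umulE.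
rewrite [RHS]uaddE; exact/uclsP/Ue_mulDr.
Qed.

(* The counit, which shows that [Uq] is not the zero ring. *)
Definition counit_gen (g : Uq_gen) : K^o := if odd_gen g then 0 else 1.

Lemma counit_rel t u : Uq_rel t u -> eval counit_gen t = eval counit_gen u.
Proof.
rewrite /counit_gen; case=> [i j|i|i|s i j|i j|s i] /=; rewrite ?scale1r
  ?mulr1 ?mulr0 ?mul0r ?scale0r ?addr0 //.
by rewrite scaleN1r subrr mulr0.
Qed.

Lemma uone_neq0 : ucls 1%:U%U != 0 :> Uq.
Proof.
apply/eqP => /uclsP /(eval_eqv counit_rel) /= /eqP.
by rewrite scale1r scale0r oner_eq0.
Qed.

HB.instance Definition _ :=
  GRing.Zmodule_isNzRing.Build Uq umulA umul1l umul1r umulDl umulDr uone_neq0.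

Lemma uscaleM c x : uscale c x = (ucls c%:U%U : Uq) * x.
Proof. by rewrite -(urepK x) uscaleE [RHS]umulE. Qed.

Lemma uscaleA a b x : uscale a (uscale b x) = uscale (a * b) x.
Proof.
rewrite !uscaleM mulrA; congr (_ * _).
by rewrite [LHS]umulE; apply/uclsP/Ue_scalM.
Qed.

Lemma uscale1 : left_id 1 uscale.
Proof. by move=> x; rewrite uscaleM -[ucls _]/(1 : Uq) mul1r. Qed.

Lemma uscaleDr : right_distributive uscale +%R.
Proof. by move=> c x y; rewrite !uscaleM mulrDr. Qed.

Lemma uscaleDl x : {morph uscale^~ x : a b / a + b}.
Proof.
move=> a b; rewrite !uscaleM -mulrDl; congr (_ * _).
by rewrite [RHS]uaddE; apply/uclsP/Ue_sym/Ue_scalD.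
Qed.

HB.instance Definition _ :=
  GRing.Zmodule_isLmodule.Build K Uq uscaleA uscale1 uscaleDr uscaleDl.

Lemma uscaleAl (c : K) (x y : Uq) : c *: (x * y) = c *: x * y.
Proof. by rewrite -![_ *: _]/(uscale _ _) !uscaleM mulrA. Qed.

HB.instance Definition _ := GRing.Lmodule_isLalgebra.Build K Uq uscaleAl.

Lemma uscaleAr (c : K) (x y : Uq) : c *: (x * y) = x * (c *: y).
Proof.
rewrite -![_ *: _]/(uscale _ _) !uscaleM !mulrA; congr (_ * _).
rewrite -(urepK x) [LHS]umulE [RHS]umulE; exact/uclsP/Ue_scalC.
Qed.

HB.instance Definition _ := GRing.Lalgebra_isAlgebra.Build K Uq uscaleAr.

Definition ugen (g : Uq_gen) : Uq := ucls (TG g).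

Lemma eval_ugen t : eval ugen t = ucls t.
Proof.
elim: t => [c|g|t IHt u IHu|t IHt u IHu] //=.
- by rewrite -[LHS]/(uscale _ _) uscaleM mulr1.
- by rewrite IHt IHu [LHS]uaddE.
- by rewrite IHt IHu [LHS]umulE.
Qed.

Lemma ugen_rel t u : Uq_rel t u -> eval ugen t = eval ugen u.
Proof. by rewrite !eval_ugen => h; apply/uclsP/Ue_rel. Qed.

Lemma Uq_ind (P : Uq -> Prop) :
  (forall c, P c%:A) -> (forall g, P (ugen g)) ->
  (forall x y, P x -> P y -> P (x + y)) ->
  (forall x y, P x -> P y -> P (x * y)) -> forall x, P x.
Proof.
move=> PC PG PD PM x; rewrite -(urepK x) -eval_ugen.
by elim: (urep x) => [c|g|t IHt u IHu|t IHt u IHu] /=; auto.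
Qed.

Section Lift.
Variables (B : algType K) (f : Uq_gen -> B).
Hypothesis fP : forall t u, Uq_rel t u -> eval f t = eval f u.

Definition Uq_lift (x : Uq) : B := eval f (urep x).

Lemma Uq_lift_cls t : Uq_lift (ucls t) = eval f t.
Proof. exact/(eval_eqv fP)/urep_cls. Qed.

Lemma Uq_lift_gen g : Uq_lift (ugen g) = f g.
Proof. exact: Uq_lift_cls. Qed.

Lemma Uq_liftD x y : Uq_lift (x + y) = Uq_lift x + Uq_lift y.
Proof.
by rewrite -(urepK x) -(urepK y) [_ + _ in LHS]uaddE !Uq_lift_cls.
Qed.

Lemma Uq_liftM x y : Uq_lift (x * y) = Uq_lift x * Uq_lift y.
Proof.
by rewrite -(urepK x) -(urepK y) [_ * _ in LHS]umulE !Uq_lift_cls.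
Qed.

Lemma Uq_liftZ c x : Uq_lift (c *: x) = c *: Uq_lift x.
Proof.
rewrite -(urepK x) [_ *: _ in LHS]uscaleE !Uq_lift_cls /=.
by rewrite -scalerAl mul1r.
Qed.

Lemma Uq_lift1 : Uq_lift 1 = 1.
Proof. by rewrite [LHS]Uq_lift_cls /= scale1r. Qed.

End Lift.

Definition parity_gen (g : Uq_gen) : Uq := (-1) ^+ odd_gen g *: ugen g.

Lemma parity_rel t u : Uq_rel t u -> eval parity_gen t = eval parity_gen u.
Proof.
move=> h; have := ugen_rel h.
case: h => [i j|i|i|s i j|i j|s i] /=;
  rewrite /parity_gen /= ?expr0 ?expr1 ?scaleN1r ?scale1r ?mulrN ?mulNr ?opprK;
  by move=> ->.
Qed.

(* a |-> (-1)^|a| a *)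
Definition parity : Uq -> Uq := Uq_lift parity_gen.

Lemma parityK : involutive parity.
Proof.
elim/Uq_ind => [c|g|x y IHx IHy|x y IHx IHy].
- by rewrite /parity !(Uq_liftZ parity_rel) !(Uq_lift1 parity_rel).
- rewrite /parity (Uq_lift_gen parity_rel) (Uq_liftZ parity_rel).
  by rewrite (Uq_lift_gen parity_rel) scalerA -expr2 sqrr_sign scale1r.
- by rewrite /parity !(Uq_liftD parity_rel) [X in X + _]IHx [X in _ + X]IHy.
- by rewrite /parity !(Uq_liftM parity_rel) [X in X * _]IHx [X in _ * X]IHy.
Qed.

Definition uhpart (i : bool) (x : Uq) : Uq :=
  2^-1 *: (x + (-1) ^+ i *: parity x).

Lemma uhpart_linear i c x y :
  uhpart i (c *: x + y) = c *: uhpart i x + uhpart i y.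
Proof.
rewrite /uhpart /parity (Uq_liftD parity_rel) (Uq_liftZ parity_rel).
rewrite [c *: (_ *: _)]scalerA [c * _]mulrC -scalerA -scalerDr; congr (_ *: _).
rewrite !scalerDr addrACA; congr (_ + _ + _).
by rewrite !scalerA mulrC.
Qed.

Lemma two_neq0 : 2 != 0 :> K. Proof. by rewrite pnatr_eq0. Qed.

Lemma uhpart_sum x : uhpart false x + uhpart true x = x.
Proof.
rewrite /uhpart -scalerDr /= scale1r scaleN1r addrACA subrr addr0.
by rewrite -mulr2n -scaler_nat scalerA mulVf ?two_neq0 ?scale1r.
Qed.

Lemma parity_uhpart j x : parity (uhpart j x) = (-1) ^+ j *: uhpart j x.
Proof.
rewrite /uhpart /parity (Uq_liftZ parity_rel) (Uq_liftD parity_rel).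
rewrite (Uq_liftZ parity_rel) -!/(parity _) parityK.
rewrite [RHS]scalerA mulrC -scalerA; congr (_ *: _).
by rewrite scalerDr scalerA -expr2 sqrr_sign scale1r addrC.
Qed.

Lemma uhpart_parity i x :
  uhpart i x = x <-> parity x = (-1) ^+ i *: x.
Proof.
split=> [<-|h]; first exact: parity_uhpart.
rewrite /uhpart h scalerA -expr2 sqrr_sign scale1r.
by rewrite -mulr2n -scaler_nat scalerA mulVf ?two_neq0 ?scale1r.
Qed.

Lemma uhpart_uhpart i j x :
  uhpart i (uhpart j x) = if i == j then uhpart j x else 0.
Proof.
have [->|ne] := eqVneq i j; first by apply/uhpart_parity/parity_uhpart.
rewrite {1}/uhpart parity_uhpart scalerA -signr_addb.
have -> : i (+) j = true by move: ne; case: i; case: j.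
by rewrite scaleN1r subrr scaler0.
Qed.

Lemma uhpart1 : uhpart false 1 = 1.
Proof. by apply/uhpart_parity; rewrite /parity (Uq_lift1 parity_rel) scale1r. Qed.

Lemma uhpartM i j x y : uhpart i x = x -> uhpart j y = y ->
  uhpart (i (+) j) (x * y) = x * y.
Proof.
move=> /uhpart_parity hx /uhpart_parity hy; apply/uhpart_parity.
rewrite /parity (Uq_liftM parity_rel) -!/(parity _) hx hy.
by rewrite -scalerAl -scalerAr scalerA signr_addb.
Qed.

HB.instance Definition _ := isSuperAlgebra.Build K Uq
  uhpart_linear uhpart_sum uhpart_uhpart uhpart1 uhpartM.

Definition xi (s : bool) (i : 'I_2) : Uq := ugen (Xi s i).
Definition k (i : 'I_3) : Uq := ugen (Kk i).
Definition kV (i : 'I_3) : Uq := ugen (KkV i).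

Lemma k_k i j : k i * k j = k j * k i.
Proof. exact: (ugen_rel (Rkk i j)). Qed.

Lemma k_kV i : k i * kV i = 1.
Proof. by have := ugen_rel (RkkV i); rewrite /= scale1r. Qed.

Lemma kV_k i : kV i * k i = 1.
Proof. by have := ugen_rel (RkVk i); rewrite /= scale1r. Qed.

Lemma k_xi_kV s i j :
  k i * xi s j * kV i = q ^ ((if s then 1 else -1) * ahat i (w23 j)) *: xi s j.
Proof. by have := ugen_rel (Rkxi s i j); rewrite /= -scalerAl mul1r. Qed.

Lemma xi_xi i j : xi true i * xi false j + xi false j * xi true i =
  ((i == j)%:R / (q - q^-1)) *: (k (w23 i) - kV (w23 i)).
Proof.
have := ugen_rel (Rxixi i j).
by rewrite /= -scalerAl mul1r -scalerAl mul1r scaleN1r.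
Qed.

Lemma xi_sqr s i : xi s i * xi s i = 0.
Proof. by have := ugen_rel (Rserre s i); rewrite /= scale0r. Qed.

Lemma serre3 s i j :
  xi s i * (xi s i * xi s j + xi s j * xi s i) -
  (xi s i * xi s j + xi s j * xi s i) * xi s i = 0.
Proof.
rewrite mulrDr mulrDl !mulrA xi_sqr mul0r -[_ * xi s i * xi s i]mulrA xi_sqr.
by rewrite mulr0 add0r addr0 subrr.
Qed.

Lemma ahat01 i j : ahat (w23 i) (w23 j) = 0.
Proof.
by case: i => -[|[|//]] ?; case: j => -[|[|//]] ?.
Qed.

(* k_0 and k_1 commute with all the ξ's since the corresponding entries of
   [ahat] vanish. *)
Lemma kxiC s i j : k (w23 i) * xi s j = xi s j * k (w23 i).
Proof.
have := k_xi_kV s (w23 i) j; rewrite ahat01 mulr0 expr0z scale1r => h.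
by rewrite -[in RHS]h -!mulrA kV_k mulr1.
Qed.

Lemma kVxiC s i j : kV (w23 i) * xi s j = xi s j * kV (w23 i).
Proof.
rewrite -[LHS]mulr1 -(k_kV (w23 i)) !mulrA -[_ * _ * k _]mulrA -kxiC mulrA.
by rewrite kV_k mul1r.
Qed.

Definition Delta_gen (g : Uq_gen) : stensor Uq :=
  match g with
  | Xi true i => xi true i ⊗ 1 + k (w23 i) ⊗ xi true i
  | Xi false i => xi false i ⊗ kV (w23 i) + 1 ⊗ xi false i
  | Kk i => k i ⊗ k i
  | KkV i => kV i ⊗ kV i
  end.

Lemma hpart_xi s i : hpart true (xi s i) = xi s i.
Proof.
by apply/uhpart_parity; rewrite [LHS](Uq_lift_gen parity_rel) /parity_gen.
Qed.

Lemma hpart_k i : hpart false (k i) = k i.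
Proof.
by apply/uhpart_parity; rewrite [LHS](Uq_lift_gen parity_rel) /parity_gen.
Qed.

Lemma hpart_kV i : hpart false (kV i) = kV i.
Proof.
by apply/uhpart_parity; rewrite [LHS](Uq_lift_gen parity_rel) /parity_gen.
Qed.

Lemma kVC i j : k i * kV j = kV j * k i.
Proof.
rewrite -[LHS]mul1r -(kV_k j) !mulrA -[_ * k j * k i]mulrA [k j * _]k_k.
by rewrite !mulrA -mulrA k_kV mulr1.
Qed.

Lemma kVkV i j : kV i * kV j = kV j * kV i.
Proof.
rewrite -[LHS]mul1r -(kV_k j) !mulrA -[_ * k j * kV i]mulrA kVC.
by rewrite !mulrA -mulrA k_kV mulr1.
Qed.

Lemma Delta_rel t u : Uq_rel t u -> eval Delta_gen t = eval Delta_gen u.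
Proof.
case=> [i j|i|i|s i j|i j|s i] /=.
- by rewrite !(stensorM_evenl _ _ _ (hpart_k _)) [in RHS]k_k.
- by rewrite (stensorM_evenl _ _ _ (hpart_k _)) k_kV scale1r.
- by rewrite (stensorM_evenl _ _ _ (hpart_kV _)) kV_k scale1r.
- rewrite -scalerAl mul1r; set c := q ^ _.
  have kxk : k i * xi s j * kV i = c *: xi s j by exact: k_xi_kV.
  case: s @c kxk => c kxk; rewrite mulrDr mulrDl;
    rewrite !(stensorM_evenl _ _ _ (hpart_k i));
    rewrite !(stensorM_evenr _ _ _ (hpart_kV i)) kxk mulr1 k_kV.
  + by rewrite k_k -mulrA k_kV mulr1 scalerDr tpureZl tpureZr.
  + by rewrite kVC -mulrA k_kV mulr1 scalerDr tpureZl tpureZr.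
- rewrite -scalerAl mul1r -scalerAl mul1r scaleN1r.
  rewrite !(mulrDl, mulrDr).
  rewrite (stensorM_evenl _ _ _ hpart1) (stensorM_evenr _ _ _ hpart1).
  rewrite (stensorM_odd _ _ (hpart_xi _ _) (hpart_xi _ _)).
  rewrite (stensorM_evenr (k _) _ _ hpart1).
  rewrite (stensorM_evenl _ _ _ (hpart_kV _)).
  rewrite (stensorM_odd _ _ (hpart_xi _ _) (hpart_xi _ _)).
  rewrite (stensorM_evenr _ _ _ (hpart_k _)) (stensorM_evenr _ _ _ (hpart_k _)).
  rewrite !mul1r !mulr1 kVxiC (kxiC false).
  rewrite [LHS](AC (2*2*(2*2)) ((1*5)*(4*8)*((2*7)*(3*6)))) /=.
  rewrite subrr addNr !addr0 -tpureDl -tpureDr !xi_xi tpureZl tpureZr -scalerDr.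
  have [->|_] := eqVneq i j; last by rewrite mul0r !scale0r.
  congr (_ *: _); rewrite tpureBl tpureBr.
  by rewrite [LHS](AC (2*2) ((3*2)*(1*4))) /= subrr addr0.
- rewrite scale0r; case: s; rewrite mulrDl !mulrDr.
  + rewrite !(stensorM_evenl _ _ _ hpart1) (stensorM_evenr _ _ _ (hpart_k _)).
    rewrite (stensorM_odd _ _ (hpart_xi _ _) (hpart_xi _ _)).
    rewrite !xi_sqr !mulr1 !mul1r kxiC tpure0l tpure0r add0r addr0.
    by rewrite subrr.
  + rewrite !(stensorM_evenl _ _ _ (hpart_kV _)) (stensorM_evenr _ _ _ hpart1).
    rewrite (stensorM_odd _ _ (hpart_xi _ _) (hpart_xi _ _)).
    rewrite !xi_sqr !mulr1 !mul1r kVxiC tpure0l tpure0r add0r addr0.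
    by rewrite subrr.
Qed.

Definition Delta : Uq -> stensor Uq := Uq_lift Delta_gen.

Lemma Delta_is_linear : linear Delta.
Proof.
by move=> c x y; rewrite /Delta (Uq_liftD Delta_rel) (Uq_liftZ Delta_rel).
Qed.

Lemma Delta_is_monoid_morphism : monoid_morphism Delta.
Proof.
by split=> [|x y]; [exact: (Uq_lift1 Delta_rel)|exact: (Uq_liftM Delta_rel)].
Qed.

HB.instance Definition _ :=
  GRing.isLinear.Build K Uq (stensor Uq) _ Delta Delta_is_linear.
HB.instance Definition _ :=
  GRing.isMonoidMorphism.Build Uq (stensor Uq) Delta Delta_is_monoid_morphism.

Lemma Delta_k i : Delta (k i) = k i ⊗ k i.
Proof. exact: (Uq_lift_gen Delta_rel). Qed.

Lemma Delta_kV i : Delta (kV i) = kV i ⊗ kV i.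
Proof. exact: (Uq_lift_gen Delta_rel). Qed.

Lemma Delta_xip i :
  Delta (xi true i) = xi true i ⊗ 1 + k (w23 i) ⊗ xi true i.
Proof. exact: (Uq_lift_gen Delta_rel). Qed.

Lemma Delta_xim i :
  Delta (xi false i) = xi false i ⊗ kV (w23 i) + 1 ⊗ xi false i.
Proof. exact: (Uq_lift_gen Delta_rel). Qed.

End Presentation.

Section CoidealSubalgebra.
Variable K : fieldType.
Local Open Scope classical_set_scope.

Definition subalgebra (A : algType K) (B : set A) : Prop :=
  [/\ B 1,
      forall (c : K) a b, B a -> B b -> B (c *: a + b) &
      forall a b, B a -> B b -> B (a * b)].

Definition gen_subalgebra (A : algType K) (S : set A) : set A :=
  smallest (@subalgebra A) S.

Definition left_coideal_subalgebra (A : superAlgType K)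
    (D : A -> stensor A) (B : set A) : Prop :=
  subalgebra B /\ forall b, B b -> tens_span [set: A] B (D b).

End CoidealSubalgebra.

Section TwistedAffine.
Variables (K : numFieldType) (q dp dm : K).
Local Open Scope classical_set_scope.

Definition xip' (i : 'I_2) : Uq q := kV q (w23 i) * xi q true i.

Definition B0p : Uq q := xip' 0 * k q 0 - dp *: (xi q false 1 * k q 0).

Definition B0m : Uq q := xi q false 0 * k q 0 - dm *: (xip' 1 * k q 0).

Definition twisted_affine : set (Uq q) :=
  gen_subalgebra [set k q 2; k q 0 * kV q 1; B0p; B0m].

End TwistedAffine.

Arguments Delta {K} q x.
Arguments twisted_affine {K} q dp dm.

(* The root lattice Z α_0 ⊕ Z α_1, in coordinates. *)
Definition alpha (i : 'I_2) : 'rV[int]_2 := delta_mx 0 i.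

(* Main.v *)
(* The coproduct is an algebra morphism and A ⊗ B is a subalgebra of the graded
   tensor square, so it suffices to look at the generators of B.  The Cartan
   generators are grouplike, and the twisted generators satisfy
     Δ(B_0^+) = (ξ'_0^+ k_0) ⊗ 1 - d_+ (ξ_1^- k_0) ⊗ k_0 k_1^-1 + k_0 ⊗ B_0^+,
     Δ(B_0^-) = (ξ_0^- k_0) ⊗ 1 - d_- (ξ'_1^+ k_0) ⊗ k_0 k_1^-1 + k_0 ⊗ B_0^-.
   Because of the signs in the graded product, A ⊗ B is closed under
   multiplication only if B contains the homogeneous components of its
   elements; it does, having homogeneous generators. *)
Require Import Defs.
From HB Require Import structures.
From mathcomp Require Import all_boot all_order all_algebra.
From mathcomp Require Import boolp classical_sets reals complex.

Set Implicit Arguments.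
Unset Strict Implicit.
Unset Printing Implicit Defensive.

Import Order.TTheory GRing.Theory Num.Theory.

Local Open Scope ring_scope.

Section GenSubalgebra.
Variables (K : fieldType) (A : algType K).
Implicit Types (B S : set A).

Lemma subalgebra0 B : subalgebra B -> B 0.
Proof. by case=> B1 BL _; rewrite -(addNr 1) -scaleN1r; exact: BL. Qed.

Lemma subalgebraD B a b : subalgebra B -> B a -> B b -> B (a + b).
Proof. by case=> _ BL _ Ba Bb; rewrite -[a]scale1r; exact: BL. Qed.

Lemma gen_subalgebra_subalgebra S : subalgebra (gen_subalgebra S).
Proof.
split=> [M [[]] //|c a b Ha Hb M MS|a b Ha Hb M MS];
  have := Hb M MS; have := Ha M MS; case: (MS) => -[M1 ML MM] _.
- exact: ML.
- exact: MM.
Qed.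

Lemma sub_gen_subalgebra S : (S `<=` gen_subalgebra S)%classic.
Proof. by move=> x Sx M [_]; exact. Qed.

Lemma gen_subalgebra_min S B :
  subalgebra B -> (S `<=` B)%classic -> (gen_subalgebra S `<=` B)%classic.
Proof. by move=> HB SB x; exact. Qed.

End GenSubalgebra.

Section TensSpan.
Variables (K : fieldType) (V W : lmodType K) (V' : set V) (W' : set W).
Local Open Scope classical_set_scope.
Local Notation span := (tens_span V' W').

Lemma tens_span0 : span 0.
Proof. by exists [::]; rewrite big_nil. Qed.

Lemma tens_spanD x y : span x -> span y -> span (x + y).
Proof.
move=> [s [Hs ->]] [t [Ht ->]]; exists (s ++ t); rewrite big_cat; split=> // p.
by rewrite mem_cat => /orP[/Hs|/Ht].
Qed.

Lemma tens_span_sum I (r : seq I) (F : I -> tens V W) :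
  (forall i, span (F i)) -> span (\sum_(i <- r) F i).
Proof.
by move=> HF; elim/big_ind: _ => //; [exact: tens_span0 | exact: tens_spanD].
Qed.

Lemma tens_span_pure v w : V' v -> W' w -> span (v ⊗ w).
Proof.
by move=> Vv Ww; exists [:: (v, w)]; rewrite big_seq1; split=> // p;
  rewrite inE => /eqP ->.
Qed.

Lemma tens_spanZ c x :
  (forall v, V' v -> V' (c *: v)) -> span x -> span (c *: x).
Proof.
move=> V'Z [s [Hs ->]]; rewrite scaler_sumr.
exists [seq (c *: p.1, p.2) | p <- s]; split=> [_ /mapP[p /Hs [? ?] ->]|].
  by split=> //; exact: V'Z.
by rewrite big_map; apply: eq_bigr => p _; rewrite tpureZl.
Qed.

End TensSpan.

Section GradedSubalgebra.
Variables (K : fieldType) (A : superAlgType K).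
Local Open Scope classical_set_scope.
Implicit Types (B S : set A).

Lemma hpartZ i c (a : A) : hpart i (c *: a) = c *: hpart i a.
Proof. by rewrite -[c *: a]addr0 hpart_linear hpart0 addr0. Qed.

Lemma hpartB i (a b : A) : hpart i (a - b) = hpart i a - hpart i b.
Proof. by rewrite hpartD -!scaleN1r hpartZ. Qed.

Lemma hpart_id i (a : A) : hpart i (hpart i a) = hpart i a.
Proof. by rewrite hpart_hpart eqxx. Qed.

(** The product is homogeneous of degree [i (+) j], so its other component vanishes. *)
Lemma hpart_homM m i j (a b : A) :
  hpart m (hpart i a * hpart j b) =
  if m == i (+) j then hpart i a * hpart j b else 0.
Proof.
by rewrite -(hpartM _ _ _ _ (hpart_id i a) (hpart_id j b)) hpart_hpart.
Qed.

Definition graded B := forall i b, B b -> B (hpart i b).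

(** The elements all of whose components lie in [gen_subalgebra S] form a subalgebra containing [S],
    so minimality applies. *)
Lemma gen_subalgebra_graded S :
  (forall x, S x -> exists i, hpart i x = x) -> graded (gen_subalgebra S).
Proof.
move=> Shom i b Bb; move: i; move: b Bb.
have HB := gen_subalgebra_subalgebra S.
have B0 := subalgebra0 HB.
have BD a c := @subalgebraD _ _ _ a c HB.
have [B1 BL BM] := HB.
apply: gen_subalgebra_min; last first.
  (* A component of a homogeneous generator is the generator itself or 0. *)
  move=> x Sx i; have [j <-] := Shom x Sx; rewrite hpart_hpart.
  case: eqP => // _; have [k xk] := Shom x Sx.
  rewrite -xk hpart_hpart; case: eqP => // _; rewrite xk.
  exact: sub_gen_subalgebra.
split=> [i|c a b Ha Hb i|a b Ha Hb m].
- by rewrite -hpart1 hpart_hpart hpart1; case: eqP.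
- by rewrite hpart_linear; exact: BL.
- rewrite -(hpart_sum a) -(hpart_sum b) mulrDl !mulrDr !hpartD !hpart_homM.
  by do !apply: (BD); case: ifP => _ //; exact: BM.
Qed.

(** By [smul_pure], (a ⊗ b)(c ⊗ d) is a signed sum of terms a c_j ⊗ b_i d over components b_i of b
    and c_j of c. Gradedness puts b_i, hence b_i d, in [B]. *)
Lemma tens_span_smul B (x y : stensor A) : subalgebra B -> graded B ->
  tens_span [set: A] B x -> tens_span [set: A] B y ->
  tens_span [set: A] B (x * y).
Proof.
move=> [_ _ BM] Bgr [s [Hs ->]] [t [Ht ->]].
rewrite mulr_suml big_seq; elim/big_ind: _.
- exact: tens_span0.
- exact: tens_spanD.
move=> p /Hs [_ Bp]; rewrite mulr_sumr big_seq; elim/big_ind: _.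
- exact: tens_span0.
- exact: tens_spanD.
move=> r /Ht [_ Br]; rewrite [_ * _]smul_pureE.
apply: tens_span_sum => i; apply: tens_span_sum => j.
(* The sign is absorbed by the first leg, which ranges over all of [A]. *)
apply: tens_spanZ => //; apply: tens_span_pure => //.
by apply: BM => //; exact: Bgr.
Qed.

(** The preimage of A ⊗ B under the algebra morphism [D] is a subalgebra, so containing [S] is
    enough. *)
Lemma left_coideal_gen_subalgebra (D : {lrmorphism A -> stensor A}) S :
  (forall x, S x -> exists i, hpart i x = x) ->
  (forall x, S x -> tens_span [set: A] (gen_subalgebra S) (D x)) ->
  left_coideal_subalgebra D (gen_subalgebra S).
Proof.
move=> Shom SD; have HB := gen_subalgebra_subalgebra S; split=> //.
apply: gen_subalgebra_min; last exact: SD.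
have [B1 _ _] := HB; split=> [|c a b Ha Hb|a b Ha Hb] /=.
- by rewrite rmorph1; exact: tens_span_pure.
- by rewrite linearP; apply: tens_spanD => //; exact: tens_spanZ.
- by rewrite rmorphM; apply: tens_span_smul => //; exact: gen_subalgebra_graded.
Qed.

End GradedSubalgebra.

Section TwistedGenerators.
Variables (K : numFieldType) (q dp dm : K).

Lemma hpart_xi_k s i j : hpart true (xi q s i * k q j) = xi q s i * k q j.
Proof. exact: (hpartM _ _ _ _ (hpart_xi _ s i) (hpart_k _ j)). Qed.

Lemma hpart_xip'_k i j : hpart true (xip' q i * k q j) = xip' q i * k q j.
Proof.
have hx := hpartM _ _ _ _ (hpart_kV q (w23 i)) (hpart_xi q true i).
exact: (hpartM _ _ _ _ hx (hpart_k _ j)).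
Qed.

Lemma hpart_B0p : hpart true (B0p q dp) = B0p q dp.
Proof. by rewrite /B0p hpartB hpartZ hpart_xip'_k hpart_xi_k. Qed.

Lemma hpart_B0m : hpart true (B0m q dm) = B0m q dm.
Proof. by rewrite /B0m hpartB hpartZ hpart_xip'_k hpart_xi_k. Qed.

Lemma Delta_xim_k i j : Delta q (xi q false i * k q j) =
  (xi q false i * k q j) ⊗ (k q j * kV q (w23 i))
    + k q j ⊗ (xi q false i * k q j).
Proof.
rewrite rmorphM /= Delta_xim Delta_k mulrDl !(stensorM_evenr _ _ _ (hpart_k _ j)).
by rewrite mul1r kVC.
Qed.

(** Twisting by k_i^-1 turns the factor k_i in Δ(ξ_i^+) into 1, so ξ'_i^+ has a coproduct of the
    same shape as ξ_i^-. *)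
Lemma Delta_xip'_k i j : Delta q (xip' q i * k q j) =
  (xip' q i * k q j) ⊗ (k q j * kV q (w23 i))
    + k q j ⊗ (xip' q i * k q j).
Proof.
rewrite !rmorphM /= Delta_xip Delta_k Delta_kV mulrDr mulrDl.
rewrite !(stensorM_evenl _ _ _ (hpart_kV _ _)).
by rewrite !(stensorM_evenr _ _ _ (hpart_k _ j)) kV_k mul1r mulr1 kVC.
Qed.

(** In the second legs, index 0 gives k_0 k_0^-1 = 1 and index 1 gives the Cartan generator k_0
    k_1^-1; the terms k_0 ⊗ _ recombine into k_0 ⊗ B_0^+. *)
Lemma Delta_B0p : Delta q (B0p q dp) =
  (xip' q 0 * k q 0) ⊗ 1
    - dp *: ((xi q false 1 * k q 0) ⊗ (k q 0 * kV q 1)) + k q 0 ⊗ B0p q dp.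
Proof.
have w0 : w23 0 = 0 by exact: val_inj.
have w1 : w23 1 = 1 by exact: val_inj.
rewrite /B0p linearB linearZ /= Delta_xip'_k Delta_xim_k w0 w1 k_kV.
by rewrite tpureBr tpureZr scalerDr opprD addrACA.
Qed.

Lemma Delta_B0m : Delta q (B0m q dm) =
  (xi q false 0 * k q 0) ⊗ 1
    - dm *: ((xip' q 1 * k q 0) ⊗ (k q 0 * kV q 1)) + k q 0 ⊗ B0m q dm.
Proof.
have w0 : w23 0 = 0 by exact: val_inj.
have w1 : w23 1 = 1 by exact: val_inj.
rewrite /B0m linearB linearZ /= Delta_xip'_k Delta_xim_k w0 w1 k_kV.
by rewrite tpureBr tpureZr scalerDr opprD addrACA.
Qed.

Lemma twisted_affine_left_coideal :
  left_coideal_subalgebra (Delta q) (twisted_affine q dp dm).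
Proof.
have genB := @sub_gen_subalgebra K (Uq q)
  [set k q 2; k q 0 * kV q 1; B0p q dp; B0m q dm]%classic.
have [B1 _ _] := gen_subalgebra_subalgebra
  [set k q 2; k q 0 * kV q 1; B0p q dp; B0m q dm]%classic.
have BK : twisted_affine q dp dm (k q 0 * kV q 1).
  by apply: genB; left; left; right.
apply: (@left_coideal_gen_subalgebra K (Uq q) (Delta q)) => x.
  (* Homogeneity: the Cartan generators are even, the twisted ones odd. *)
  case=> [[[->|->]|->]|->].
  - by exists false; exact: hpart_k.
  - by exists false; exact: (hpartM _ _ _ _ (hpart_k _ 0) (hpart_kV _ 1)).
  - by exists true; exact: hpart_B0p.
  - by exists true; exact: hpart_B0m.
case=> [[[->|->]|->]|->] /=.
- by rewrite Delta_k; apply: tens_span_pure => //; apply: genB; left; left; left.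
- rewrite rmorphM /= Delta_k Delta_kV (stensorM_evenl _ _ _ (hpart_k _ 0)).
  exact: tens_span_pure.
- rewrite Delta_B0p; apply: tens_spanD.
    (* The scalar -d_+ moves into the unrestricted first leg; the second legs 1 and k_0 k_1^-1 lie
       in B. *)
    rewrite -scaleNr -tpureZl; apply: tens_spanD; exact: tens_span_pure.
  by apply: tens_span_pure => //; apply: genB; left; right.
- rewrite Delta_B0m; apply: tens_spanD.
    rewrite -scaleNr -tpureZl; apply: tens_spanD; exact: tens_span_pure.
  by apply: tens_span_pure => //; apply: genB; right.
Qed.

End TwistedGenerators.

Theorem proposition4p1 (R : realType) (q : R[i]) (q_neq0 : q != 0)
    (q_transcendental : ~ algebraicOver (ratr : rat -> R[i]) q)
    (Theta : {additive 'rV[int]_2 -> 'rV[int]_2}) (ThetaK : involutive Theta)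
    (Theta_alpha0 : Theta (alpha 0) = - alpha 1)
    (dp dm : R[i]) :
  left_coideal_subalgebra (Delta q) (twisted_affine q dp dm).
Proof. exact: twisted_affine_left_coideal. Qed.
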